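(* Let $E$ be a free left $A_n$-module with free generators $e_1,\dots,e_m$, and let $G=\{g_1,\dots,g_s\}$ be a finite set of nonzero elements of $E$. Let $N=\langle g_1,\dots,g_s\rangle=A_ng_1+\cdots+A_ng_s$. Then $G$ is a Gröbner basis for $N$ (with respect to the monomial order $<$ on $\Theta e$) if and only if for all $i\neq j$, $$S(g_i,g_j)\xrightarrow{G}0.$$
   Context: Let $K$ be a field of characteristic $0$ and $n\ge 1$. $A_n=A_n(K)$ is the $n$th Weyl algebra: the $K$-subalgebra of $\mathrm{End}_K(K[x_1,\dots,x_n])$ generated by the multiplication operators $x_1,\dots,x_n$ and the partial derivatives $\partial_1,\dots,\partial_n$. Modules are unitary left modules. $\mathbb N$ includes $0$. For $\alpha,\beta\in\mathbb N^n$, $x^\alpha\partial^\beta=x_1^{\alpha_1}\cdots x_n^{\alpha_n}\partial_1^{\beta_1}\cdots\partial_n^{\beta_n}$ is called a monomial, of degree $|\alpha|+|\beta|=\sum_i\alpha_i+\sum_i\beta_i$. $\Theta$ is the set of all monomials; it is a $K$-basis of $A_n$. Order on $\Theta$: $x^\alpha\partial^\beta<x^\gamma\partial^\delta$ iff $(|\alpha|+|\beta|,\alpha_1,\dots,\alpha_n,\beta_1,\dots,\beta_n)$ is smaller than $(|\gamma|+|\delta|,\gamma_1,\dots,\gamma_n,\delta_1,\dots,\delta_n)$ in the lexicographic order on $\mathbb N^{2n+1}$. Divisibility: $\theta=x^\alpha\partial^\beta$ divides $\theta'=x^\gamma\partial^\delta$ iff $\alpha_i\le\gamma_i$ and $\beta_i\le\delta_i$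 for all $i$; then $\frac{\theta'}{\theta}:=x^{\gamma-\alpha}\partial^{\delta-\beta}$. The least common multiple $\mathrm{lcm}(\theta,\theta')$ is the monomial whose exponents are the componentwise maxima. For $E$ free on $e_1,\dots,e_m$, the monomials of $E$ are the elements of $\Theta e=\{\theta e_i:\theta\in\Theta,\ 1\le i\le m\}$, a $K$-basis of $E$, with $\theta e_i<\theta'e_j$ iff $\theta<\theta'$, or $\theta=\theta'$ and $i<j$. $\theta e_j$ divides $\theta'e_i$ iff $i=j$ and $\theta$ divides $\theta'$, and then $\frac{\theta'e_i}{\theta e_i}:=\frac{\theta'}{\theta}$; for terms, $\frac{c_1u}{c_2v}:=c_1c_2^{-1}\frac uv$ ($c_1,c_2\in K$, $c_2\ne0$). $\mathrm{lcm}(\theta e_i,\theta'e_j)$ is $\mathrm{lcm}(\theta,\theta')e_i$ if $i=j$ and $0$ if $i\neq j$. For $0\ne f\in E$, $LM(f)$ is the greatest monomial appearing in $f$ with nonzero coefficient, $LC(f)$ its coefficient, and $LT(f)=LC(f)LM(f)$. One-step reduction: for $g\neq0$, $f\xrightarrow{g}h$ means that some monomial $w$ appears in $f$ with coefficient $a\ne0$, $LM(g)$ divides $w$, and $h=f-\frac{aw}{LT(g)}g$. For a finite set $G$ of nonzero elements, $f\xrightarrow{G}h$ means that $h$ is obtained from $f$ by a finite (possibly empty) sequence of one-step reductions modulo elements of $G$; in particular $0\xrightarrow{G}0$. S-polynomial: for nonzero $f,g\in E$ with $L=\mathrm{lcm}(LM(f),LM(g))$, $S(f,g)=\frac{L}{LT(f)}f-\frac{L}{LT(g)}g$;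 in particular $S(f,g)=0$ if $L=0$. Gröbner basis: a finite set $G=\{g_1,\dots,g_s\}$ of nonzero elements of a submodule $N\subseteq E$ is a Gröbner basis for $N$ if for every nonzero $f\in N$ there is $g_i\in G$ such that $LM(g_i)$ divides $LM(f)$. *)

(* Defs.v *)
From HB Require Import structures.
From mathcomp Require Import all_boot all_order all_algebra.
From mathcomp Require Import boolp finmap.
From mathcomp Require Import mpoly.
From Stdlib Require Import Relation_Operators.

Set Implicit Arguments.
Unset Strict Implicit.
Unset Printing Implicit Defensive.

Import GRing.Theory.
Local Open Scope ring_scope.

(** The K-algebra End_K(K[x_1, ..., x_n]), multiplication being composition. *)
Definition endo (K : fieldType) (n : nat) : Type :=
  {linear {mpoly K[n]} -> {mpoly K[n]}}.

Section Endo.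
Variables (K : fieldType) (n : nat).
Local Notation P := {mpoly K[n]}.
Local Notation End := (endo K n).
Implicit Types f g h : End.

HB.instance Definition _ := gen_eqMixin End.
HB.instance Definition _ := gen_choiceMixin End.

Definition endo_fun f : P -> P := f.

Lemma endoP f g : endo_fun f =1 endo_fun g -> f = g.
Proof.
case: f g => [f [[fA] [fZ]]] [g [[gA] [gZ]]]; rewrite /endo_fun /= => /funext fg.
by case: _ / fg in gA gZ *; rewrite (Prop_irrelevance gA fA)
  (Prop_irrelevance gZ fZ).
Qed.

Definition endo_zero : End := \0.
Definition endo_opp f : End := GRing.opp_fun f.
Definition endo_add f g : End := f \+ g.
Definition endo_one : End := idfun.
Definition endo_mul f g : End := f \o g.
Definition endo_scale (c : K) f : End := c \*: f.

Fact endo_addA : associative endo_add.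
Proof. by move=> f g h; apply: endoP => p; apply: addrA. Qed.
Fact endo_addC : commutative endo_add.
Proof. by move=> f g; apply: endoP => p; apply: addrC. Qed.
Fact endo_add0 : left_id endo_zero endo_add.
Proof. by move=> f; apply: endoP => p; apply: add0r. Qed.
Fact endo_addN : left_inverse endo_zero endo_opp endo_add.
Proof. by move=> f; apply: endoP => p; apply: addNr. Qed.

HB.instance Definition _ :=
  GRing.isZmodule.Build End endo_addA endo_addC endo_add0 endo_addN.

Fact endo_mulA : associative endo_mul.
Proof. by move=> f g h; apply: endoP. Qed.
Fact endo_mul1 : left_id endo_one endo_mul.
Proof. by move=> f; apply: endoP. Qed.
Fact endo_mulr1 : right_id endo_one endo_mul.
Proof. by move=> f; apply: endoP. Qed.
Fact endo_mulDl : left_distributive endo_mul +%R.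
Proof. by move=> f g h; apply: endoP. Qed.
Fact endo_mulDr : right_distributive endo_mul +%R.
Proof. by move=> f g h; apply: endoP => p; apply: (raddfD f). Qed.
Fact endo_one_neq0 : endo_one != 0.
Proof.
apply/eqP => /(congr1 (fun f => endo_fun f 1)) /eqP.
by rewrite /endo_fun /= (oner_eq0 P).
Qed.

HB.instance Definition _ := GRing.Zmodule_isNzRing.Build End
  endo_mulA endo_mul1 endo_mulr1 endo_mulDl endo_mulDr endo_one_neq0.

Fact endo_scaleA a b f : endo_scale a (endo_scale b f) = endo_scale (a * b) f.
Proof. by apply: endoP => p; apply: scalerA. Qed.
Fact endo_scale1 : left_id 1 endo_scale.
Proof. by move=> f; apply: endoP => p; apply: scale1r. Qed.
Fact endo_scaleDr : right_distributive endo_scale +%R.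
Proof. by move=> a f g; apply: endoP => p; apply: scalerDr. Qed.
Fact endo_scaleDl f : {morph endo_scale^~ f : a b / a + b}.
Proof. by move=> a b; apply: endoP => p; apply: scalerDl. Qed.

HB.instance Definition _ := GRing.Zmodule_isLmodule.Build K End
  endo_scaleA endo_scale1 endo_scaleDr endo_scaleDl.

Fact endo_scaleAl (a : K) f g : a *: (f * g) = a *: f * g.
Proof. by apply: endoP. Qed.
HB.instance Definition _ := GRing.Lmodule_isLalgebra.Build K End endo_scaleAl.

Fact endo_scaleAr (a : K) f g : a *: (f * g) = f * (a *: g).
Proof. by apply: endoP => p; exact: esym (linearZZ f a (endo_fun g p)). Qed.
HB.instance Definition _ := GRing.Lalgebra_isAlgebra.Build K End endo_scaleAr.

Definition endo_mulX (i : 'I_n) : End := 'X_i \*o idfun.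
Definition endo_deriv (i : 'I_n) : End := mderiv i.

End Endo.

(** Membership in the smallest K-subalgebra of End_K(K[x_1, ..., x_n])
    containing the x_i and the d/dx_i. *)
Definition in_weyl (K : fieldType) (n : nat) : {pred endo K n} := fun u =>
  `[< forall S : {pred endo K n}, GRing.subalg_closed S ->
        (forall i, endo_mulX K i \in S) -> (forall i, endo_deriv K i \in S) ->
        u \in S >].

Arguments in_weyl : clear implicits.

Fact in_weyl_closed (K : fieldType) (n : nat) :
  GRing.subalg_closed (in_weyl K n).
Proof.
split; first by apply/asboolP => S [].
- move=> a u v /asboolP Su /asboolP Sv; apply/asboolP => S Sa Sx Sd.
  by case: (Sa) => _ Slin _; apply: Slin; [apply: Su|apply: Sv].
- move=> u v /asboolP Su /asboolP Sv; apply/asboolP => S Sa Sx Sd.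
  by case: (Sa) => _ _ Smul; apply: Smul; [apply: Su|apply: Sv].
Qed.

Record weyl (K : fieldType) (n : nat) : Type :=
  Weyl { weyl_val : endo K n; weyl_valP : weyl_val \in in_weyl K n }.

Section WeylAlgebra.
Variables (K : fieldType) (n : nat).
Local Notation A := (weyl K n).

HB.instance Definition _ := GRing.isSubalgClosed.Build K (endo K n)
  (in_weyl K n) (GRing.subalg_closed_semi (in_weyl_closed K n)).
HB.instance Definition _ := [isSub for @weyl_val K n].
HB.instance Definition _ := [Choice of A by <:].
HB.instance Definition _ := [SubChoice_isSubNzRing of A by <:].
HB.instance Definition _ := [SubZmodule_isSubLmodule of A by <:].
HB.instance Definition _ := [SubNzRing_SubLmodule_isSubLalgebra of A by <:].
HB.instance Definition _ := [SubLalgebra_isSubAlgebra of A by <:].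

Fact in_weyl_mulX i : endo_mulX K i \in in_weyl K n.
Proof. by apply/asboolP => S _ Sx _. Qed.
Fact in_weyl_deriv i : endo_deriv K i \in in_weyl K n.
Proof. by apply/asboolP => S _ _ Sd. Qed.

Definition weyl_X (i : 'I_n) : A := Weyl (in_weyl_mulX i).
Definition weyl_D (i : 'I_n) : A := Weyl (in_weyl_deriv i).

End WeylAlgebra.

(** x^a d^b is encoded by the pair of exponents (a, b). *)
Definition mon (n : nat) : Type := ('X_{1..n} * 'X_{1..n})%type.

Section Monomials.
Variables (K : fieldType) (n : nat).
Implicit Types t u : mon n.

Definition mon_val t : weyl K n :=
  (\prod_(i < n) weyl_X K i ^+ t.1 i) * (\prod_(i < n) weyl_D K i ^+ t.2 i).

(** The vector (|a| + |b|, a_1, ..., a_n, b_1, ..., b_n); all keys have the same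
    length, so that [seqlexi] compares them in the lexicographic order. *)
Definition mon_key t : seq nat :=
  (mdeg t.1 + mdeg t.2)%N :: [seq t.1 i | i <- enum 'I_n]
    ++ [seq t.2 i | i <- enum 'I_n].

Definition mon_lt t u : bool :=
  ((mon_key t : seqlexi nat) < mon_key u)%O.

Definition mon_dvd t u : bool := (t.1 <= u.1)%MM && (t.2 <= u.2)%MM.

(** u / t, meaningful when t divides u. *)
Definition mon_quo u t : mon n := ((u.1 - t.1)%MM, (u.2 - t.2)%MM).

Definition mon_lcm t u : mon n := (mlcm t.1 u.1, mlcm t.2 u.2).

End Monomials.

Definition free_generators (R : nzRingType) (E : lmodType R) (m : nat)
    (e : 'I_m -> E) : Prop :=
  forall f : E, exists! a : {ffun 'I_m -> R}, f = \sum_(i < m) a i *: e i.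

(** The monomial t e_i is encoded by the pair (t, i). *)
Definition emon (n m : nat) : Type := (mon n * 'I_m)%type.

Section FreeModuleMonomials.
Variables (n m : nat).
Implicit Types u v : emon n m.

Definition emon_lt u v : bool :=
  mon_lt u.1 v.1 || (u.1 == v.1) && (u.2 < v.2)%N.

Definition emon_dvd u v : bool := (u.2 == v.2) && mon_dvd u.1 v.1.

(** [None] stands for the value 0. *)
Definition emon_lcm u v : option (emon n m) :=
  if u.2 == v.2 then Some (mon_lcm u.1 v.1, u.2) else None.

End FreeModuleMonomials.

(** (a u) / (b v), meaningful when v divides u and b != 0. *)
Definition term_quo (K : fieldType) (n m : nat) (a : K) (u : emon n m)
    (b : K) (v : emon n m) : weyl K n :=
  (a / b) *: mon_val K (mon_quo u.1 v.1).

Section Groebner.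
Variables (K : fieldType) (n m : nat).
Variables (E : lmodType (weyl K n)) (e : 'I_m -> E).
Implicit Types f g h : E.

Definition expansion f (c : {fsfun emon n m -> K with 0}) : Prop :=
  f = \sum_(u <- finsupp c) (c u *: mon_val K u.1) *: e u.2.

(** The coefficients of f on the monomials t e_i.  The description operator
    picks the only expansion of f: when K has characteristic 0 and e is a free
    family of generators, the monomials form a K-basis of E. *)
Definition coefs f : {fsfun emon n m -> K with 0} :=
  if pselect (exists c, expansion f c) is left ex then projT1 (cid ex)
  else [fsfun].

(** LM(f), which is [None] exactly when f has no coefficient, i.e. f = 0. *)
Definition LM f : option (emon n m) :=
  ohead [seq u <- finsupp (coefs f) |
           all (fun v => (v == u) || emon_lt v u) (finsupp (coefs f))].

Definition LC f : K := if LM f is Some u then coefs f u else 0.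

(** f -->_g h *)
Definition reduces1 g f h : Prop :=
  g <> 0 /\
  exists v w : emon n m,
    [/\ LM g = Some v, w \in finsupp (coefs f), emon_dvd v w &
        h = f - term_quo (coefs f w) w (LC g) v *: g].

(** f -->_G h, for G = {g_1, ..., g_s} *)
Definition reduces (s : nat) (G : 'I_s -> E) : E -> E -> Prop :=
  clos_refl_trans_1n E (fun f h => exists i, reduces1 (G i) f h).

Definition Spoly f g : E :=
  if (LM f, LM g) is (Some u, Some v) then
    if emon_lcm u v is Some L then
      term_quo 1 L (LC f) u *: f - term_quo 1 L (LC g) v *: g
    else 0
  else 0.

Definition submod_gen (s : nat) (G : 'I_s -> E) (f : E) : Prop :=
  exists a : 'I_s -> weyl K n, f = \sum_(i < s) a i *: G i.

(** N is meant to be the carrier of a submodule of E, and G enumerates the finite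
    set {g_1, ..., g_s}. *)
Definition groebner_basis (N : E -> Prop) (s : nat) (G : 'I_s -> E) : Prop :=
  (forall i, N (G i) /\ G i <> 0) /\
  (forall f, N f -> f <> 0 ->
     exists i u v, [/\ LM (G i) = Some u, LM f = Some v & emon_dvd u v]).

End Groebner.

(* Main.v *)
(** The product of two monomials of the Weyl algebra is the monomial with the
    added exponents plus terms of lower degree, and the monomials are linearly
    independent (apply a vanishing combination to [x^b], [b] being of least
    degree among the exponents of the derivatives that occur in it).  Hence
    leading monomials in [E] multiply as in the commutative case.  If the
    S-polynomials reduce to [0], write [f] in [N] as a combination of products
    [theta g_i] with leading monomials at most [w].  Two products with leading
    monomial exactly [w] differ, up to scalars, by a multiple of an S-polynomial
    and terms of lower degree, hence by a combination of products with leading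
    monomials below [w].  So either [w = LM f], and it is divisible by some
    [LM g_i], or [w] can be lowered; conclude by well-founded induction on [w]. *)

Require Import Defs.
From mathcomp Require Import all_boot all_order all_algebra.
From mathcomp Require Import boolp finmap mpoly.
From Stdlib Require Import Relation_Operators.

Set Implicit Arguments.
Unset Strict Implicit.
Unset Printing Implicit Defensive.

Import Order.TTheory GRing.Theory.

(** * The monomial order *)

Section MonomialOrder.
Variables (n m : nat).
Implicit Types (t : mon n) (u v w : emon n m).

Definition mon_mul t1 t2 : mon n := ((t1.1 + t2.1)%MM, (t1.2 + t2.2)%MM).

Definition mon_deg t := (mdeg t.1 + mdeg t.2)%N.

Definition emon_mul t u : emon n m := (mon_mul t u.1, u.2).

Lemma mon_mulA : associative mon_mul.
Proof. by case=> a b [c d] [f g]; rewrite /mon_mul /= !addmA. Qed.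

Lemma mon_degM t1 t2 : mon_deg (mon_mul t1 t2) = (mon_deg t1 + mon_deg t2)%N.
Proof. by rewrite /mon_deg /= !mdegD addnACA. Qed.

Lemma emon_mulA t1 t2 u : emon_mul t1 (emon_mul t2 u) = emon_mul (mon_mul t1 t2) u.
Proof. by rewrite /emon_mul /= mon_mulA. Qed.

(** With the generator index placed last, the order on monomials of [E] is a single lexicographic
    order on sequences of equal length. *)
Definition emon_key u : seqlexi nat := rcons (mon_key u.1) (val u.2).

Lemma size_mon_key t : size (mon_key t) = (n + n).+1.
Proof. by rewrite /mon_key /= size_cat !size_map -enumT -cardT card_ord. Qed.

Lemma mon_key_inj : injective (@mon_key n).
Proof.
case=> a b [c d] /= /eqP; rewrite /mon_key /= eqseq_cons eqseq_cat ?size_map //.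
case/and3P => _ /eqP /eq_in_map eq1 /eqP /eq_in_map eq2.
by congr pair; apply/mnmP => i; [apply: eq1|apply: eq2]; rewrite mem_enum.
Qed.

Lemma emon_key_inj : injective emon_key.
Proof.
case=> t i [t' j] /eqP; rewrite eqseq_rcons => /andP[/eqP /mon_key_inj /= ->].
by move=> /eqP /val_inj ->.
Qed.

Lemma ltxi_consE x y (s1 s2 : seq nat) :
  ((x :: s1 : seqlexi nat) < y :: s2)%O
    = (x <= y)%N && ((y <= x)%N ==> ((s1 : seqlexi nat) < s2)%O).
Proof. by []. Qed.

Lemma ltxi_rcons (s1 s2 : seq nat) x y : size s1 = size s2 ->
  ((rcons s1 x : seqlexi nat) < rcons s2 y)%O
    = ((s1 : seqlexi nat) < s2)%O || (s1 == s2) && (x < y)%N.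
Proof.
elim: s1 s2 => [|a s1 IH] [|b s2] //=.
  by rewrite !ltxi_consE ltxx implybF -ltnNge andb_idl => // /ltnW.
move=> [sz]; rewrite !ltxi_consE IH // eqseq_cons.
by case: (ltngtP a b).
Qed.

Lemma emon_ltE u v : emon_lt u v = (emon_key u < emon_key v)%O.
Proof.
rewrite /emon_lt ltxi_rcons ?size_mon_key // /mon_lt.
by rewrite (inj_eq mon_key_inj).
Qed.

Definition emon_le u v := (u == v) || emon_lt u v.

Lemma emon_leE u v : emon_le u v = (emon_key u <= emon_key v)%O.
Proof. by rewrite /emon_le emon_ltE le_eqVlt (inj_eq emon_key_inj). Qed.

Lemma emon_lt_trans : transitive (@emon_lt n m).
Proof. by move=> v u w; rewrite !emon_ltE; apply: lt_trans. Qed.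

Lemma emon_ltxx u : emon_lt u u = false.
Proof. by rewrite emon_ltE ltxx. Qed.

Lemma emon_lexx u : emon_le u u.
Proof. by rewrite emon_leE. Qed.

Lemma emon_le_trans : transitive emon_le.
Proof. by move=> v u w; rewrite !emon_leE; apply: le_trans. Qed.

Lemma emon_le_total : total emon_le.
Proof. by move=> u v; rewrite !emon_leE; apply: le_total. Qed.

Lemma emon_lt_deg u v : (mon_deg u.1 < mon_deg v.1)%N -> emon_lt u v.
Proof.
move=> lt_uv; rewrite emon_ltE /emon_key /mon_key.
by rewrite !rcons_cons ltxi_consE (ltnW lt_uv) leqNgt lt_uv.
Qed.

Lemma emon_deg_le u v : emon_lt u v -> (mon_deg u.1 <= mon_deg v.1)%N.
Proof.
by rewrite emon_ltE /emon_key /mon_key !rcons_cons ltxi_consE => /andP[].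
Qed.

Definition addseq (s1 s2 : seq nat) := [seq p.1 + p.2 | p <- zip s1 s2]%N.

(** Translation invariance of the lexicographic order; keys being additive in the exponents, it
    makes the monomial order compatible with multiplication. *)
Lemma ltxi_addseq (s s1 s2 : seq nat) : size s = size s1 -> size s = size s2 ->
  ((addseq s s1 : seqlexi nat) < addseq s s2)%O = ((s1 : seqlexi nat) < s2)%O.
Proof.
elim: s s1 s2 => [|a s IH] [|b s1] [|c s2] //= [sz1] [sz2].
by rewrite !ltxi_consE -!/(addseq _ _) IH // !leq_add2l.
Qed.

(** Multiplication leaves the generator index unchanged, whence the final 0 in the translation
    vector. *)
Lemma emon_key_mul t u :
  emon_key (emon_mul t u) = addseq (rcons (mon_key t) 0%N) (emon_key u).
Proof.
rewrite /emon_key /addseq zip_rcons ?size_mon_key // map_rcons; congr rcons.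
rewrite /mon_key /= !mdegD addnACA; congr cons.
rewrite zip_cat ?size_map // map_cat; congr cat.
  by elim: (enum _) => //= i r ->; rewrite mnmDE.
by elim: (enum _) => //= i r ->; rewrite mnmDE.
Qed.

Lemma emon_lt_mul2l t u v : emon_lt (emon_mul t u) (emon_mul t v) = emon_lt u v.
Proof.
by rewrite !emon_ltE !emon_key_mul ltxi_addseq // !size_rcons !size_mon_key.
Qed.

(* Each monomial has finitely many predecessors: their degree is bounded. *)
Lemma emon_lt_wf : well_founded (@emon_lt n m).
Proof.
move=> u0; set d := mon_deg u0.1.
pose T : finType := (('X_{1..n < d.+1} * 'X_{1..n < d.+1}) * 'I_m)%type.
pose emb (x : T) : emon n m := ((bmnm x.1.1, bmnm x.1.2), x.2).
have embP v : (mon_deg v.1 <= d)%N -> exists x, emb x = v.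
  case: v => [[a b] i]; rewrite /mon_deg /= => ab_d.
  have a_d : (mdeg a < d.+1)%N by rewrite ltnS (leq_trans _ ab_d) ?leq_addr.
  have b_d : (mdeg b < d.+1)%N by rewrite ltnS (leq_trans _ ab_d) ?leq_addl.
  by exists ((BMultinom a_d, BMultinom b_d), i).
(* Induction on the number of predecessors in [T]: a [w] below [v] has strictly fewer, since [w]
   itself is lost. *)
have acc k v : (mon_deg v.1 <= d)%N ->
    (#|[pred x : T | emon_lt (emb x) v]| < k)%N -> Acc (@emon_lt n m) v.
  elim: k v => [v _|k IH v v_d v_k]; first by rewrite ltn0.
  constructor => w lt_wv.
  have w_d := leq_trans (emon_deg_le lt_wv) v_d.
  move: v_k; rewrite ltnS => v_k; apply: (IH w w_d); apply: leq_trans v_k.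
  apply: proper_card; rewrite properE; apply/andP; split.
    by apply/subsetP => x; rewrite !inE => /emon_lt_trans; apply.
  have [x x_w] := embP w w_d; apply/subsetPn; exists x; rewrite !inE x_w //.
  by rewrite emon_ltxx.
exact: (acc _ u0 (leqnn _) (ltnSn _)).
Qed.

End MonomialOrder.

(** * Linear spans over [K] in modules over a [K]-algebra *)

Section Span.
Local Open Scope ring_scope.
Variables (K : fieldType) (A : algType K).

(** [M] is only an [A]-module, so a scalar [c] of [K] acts through [c%:A]. The inductive form allows
    induction on the number of terms. *)
Inductive kspan (M : lmodType A) (T : Type) (F : T -> M) (P : T -> Prop) :
    M -> Prop :=
| kspan0 : kspan F P 0
| kspan_add c t f : P t -> kspan F P f -> kspan F P (c%:A *: F t + f).

Variables (M : lmodType A) (T : Type) (F : T -> M).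
Implicit Types (P : T -> Prop).

Lemma kspan_gen P t : P t -> kspan F P (F t).
Proof.
by move=> Pt; have := kspan_add 1 Pt (kspan0 F P); rewrite !scale1r addr0.
Qed.

Lemma kspanD P f g : kspan F P f -> kspan F P g -> kspan F P (f + g).
Proof.
elim=> [|c t h Pt _ IH] Pg; first by rewrite add0r.
by rewrite -addrA; apply: kspan_add => //; apply: IH.
Qed.

Lemma kspanZ P c f : kspan F P f -> kspan F P (c%:A *: f).
Proof.
elim=> [|a t h Pt _ IH]; first by rewrite scaler0; apply: kspan0.
rewrite scalerDr scalerA -scalerAl mul1r scalerA.
exact: kspan_add.
Qed.

Lemma kspanN P f : kspan F P f -> kspan F P (- f).
Proof. by move=> /(kspanZ (-1)); rewrite scaleN1r scaleNr scale1r. Qed.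

Lemma kspanB P f g : kspan F P f -> kspan F P g -> kspan F P (f - g).
Proof. by move=> Pf /kspanN; apply: kspanD. Qed.

End Span.

(** Linearity is asked over [K] only: left multiplication by an element of [A] is not [A]-linear in
    general, yet must be covered. *)
Lemma kspan_map (K : fieldType) (A : algType K) (M1 M2 : lmodType A)
    (T1 T2 : Type) (F1 : T1 -> M1) (F2 : T2 -> M2)
    (P1 : T1 -> Prop) (P2 : T2 -> Prop) (h : M1 -> M2) :
  (forall c f g, h (c%:A *: f + g) = c%:A *: h f + h g)%R ->
  (forall t, P1 t -> kspan F2 P2 (h (F1 t))) ->
  forall f, kspan F1 P1 f -> kspan F2 P2 (h f).
Proof.
move=> hlin hF f; elim=> [|c t g Pt _ IH].
  have := hlin 1%R 0%R 0%R; rewrite scaler0 addr0 !scale1r.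
  by rewrite -{1}[h 0%R]addr0 => /addrI <-; apply: kspan0.
by rewrite hlin; apply: kspanD => //; apply/kspanZ/hF.
Qed.

Lemma kspan_sub (K : fieldType) (A : algType K) (M : lmodType A)
    (T : Type) (F : T -> M) (P Q : T -> Prop) (f : M) :
  (forall t, P t -> Q t) -> kspan F P f -> kspan F Q f.
Proof.
by move=> PQ; apply: (kspan_map (h := id)) => // t /PQ; apply: kspan_gen.
Qed.

(** * The basis of monomials of the Weyl algebra *)

Section Weyl.
Local Open Scope ring_scope.
Variables (K : fieldType) (n : nat).
Local Notation A := (weyl K n).
Implicit Types (a b : 'X_{1..n}) (t u : mon n) (p : {mpoly K[n]}).

Definition weyl_app (x : A) p : {mpoly K[n]} := endo_fun (weyl_val x) p.

Lemma weyl_ext (x y : A) : weyl_app x =1 weyl_app y -> x = y.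
Proof. by move=> xy; apply/val_inj/endoP. Qed.

Lemma weyl_appM x y p : weyl_app (x * y) p = weyl_app x (weyl_app y p).
Proof. by []. Qed.

Lemma weyl_appD x y p : weyl_app (x + y) p = weyl_app x p + weyl_app y p.
Proof. by []. Qed.

Lemma weyl_appZ c x p : weyl_app (c *: x) p = c *: weyl_app x p.
Proof. by []. Qed.

Lemma weyl_app0 p : weyl_app 0 p = 0.
Proof. by []. Qed.

Lemma weyl_app_sum (I : Type) (r : seq I) (F : I -> A) p :
  weyl_app (\sum_(i <- r) F i) p = \sum_(i <- r) weyl_app (F i) p.
Proof.
by elim: r => [|i r IH]; rewrite ?big_nil // !big_cons weyl_appD IH.
Qed.

(** An element of the Weyl algebra is determined by its action on polynomials, so identities between
    monomials are checked through this formula. *)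
Lemma mon_valE t p : weyl_app (mon_val K t) p = 'X_[t.1] * p^`M[t.2].
Proof.
rewrite /mon_val weyl_appM.
have -> q : weyl_app (\prod_(i < n) weyl_X K i ^+ t.1 i) q = 'X_[t.1] * q.
  rewrite mpolyXE_id; elim/big_rec2: _ q => [q|i y1 y2 _ IH q]; first by rewrite mul1r.
  rewrite weyl_appM IH; elim: (t.1 i) => [|k IHk]; first by rewrite !expr0 !mul1r.
  by rewrite !exprS weyl_appM IHk -!mulrA.
congr (_ * _); rewrite [t.2 in RHS]multinomUE_id.
elim/big_rec2: _ p => [p|i y1 y2 _ IH p]; first by rewrite mderivm0m.
rewrite weyl_appM IH addmC mderivmDm; elim: (t.2 i) => [|k IHk].
  by rewrite expr0 mulm0n mderivm0m.
by rewrite exprS weyl_appM IHk mulmS addmC mderivmDm mderivmU1m.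
Qed.

Lemma mon_val0 : mon_val K (0%MM, 0%MM) = 1 :> A.
Proof. by apply: weyl_ext => p; rewrite mon_valE mderivm0m mpolyX0 mul1r. Qed.

Lemma mon_valX (i : 'I_n) : mon_val K ((U_(i), 0)%MM : mon n) = weyl_X K i.
Proof. by apply: weyl_ext => p; rewrite mon_valE mderivm0m. Qed.

Lemma mon_valD (i : 'I_n) : mon_val K ((0, U_(i))%MM : mon n) = weyl_D K i.
Proof. by apply: weyl_ext => p; rewrite mon_valE mderivmU1m mpolyX0 mul1r. Qed.

Lemma mon_valXM a t :
  mon_val K (a, 0%MM) * mon_val K t = mon_val K (mon_mul (a, 0%MM) t).
Proof.
apply: weyl_ext => p; rewrite weyl_appM !mon_valE mderivm0m /= add0m.
by rewrite mpolyXD mulrA.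
Qed.

(** The Leibniz rule. Truncated subtraction is harmless: when the exponent of [x_i] is 0, so is the
    coefficient of the last term. *)
Lemma weyl_DM (i : 'I_n) t : weyl_D K i * mon_val K t =
  mon_val K (mon_mul ((0, U_(i))%MM : mon n) t) +
  (t.1 i)%:R *: mon_val K ((t.1 - U_(i))%MM, t.2).
Proof.
apply: weyl_ext => p; rewrite weyl_appD weyl_appZ weyl_appM !mon_valE /= add0m.
rewrite [weyl_app _ _]mderivM mderivX addrC scalerAl.
by rewrite [(U_(i) + _)%MM]addmC mderivmDm mderivmU1m.
Qed.

(** The algebra is taken as the regular module [A^o], so that the span lemmas apply to it. *)
Definition wspan (P : mon n -> Prop) : A -> Prop := kspan (M := A^o) (@mon_val K n) P.

Lemma wspan_gen (P : mon n -> Prop) t : P t -> wspan P (mon_val K t).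
Proof. by move=> Pt; apply: (kspan_gen (M := A^o)). Qed.

Lemma wspanD P x y : wspan P x -> wspan P y -> wspan P (x + y).
Proof. exact: (kspanD (M := A^o)). Qed.

Lemma wspanZ P c x : wspan P x -> wspan P (c *: x).
Proof. by rewrite -mulr_algl; apply: (kspanZ (M := A^o)). Qed.

Lemma wspan_map (P1 P2 : mon n -> Prop) (h : A -> A) :
  linear h -> (forall t, P1 t -> wspan P2 (h (mon_val K t))) ->
  forall x, wspan P1 x -> wspan P2 (h x).
Proof.
move=> hlin hmon; apply: (kspan_map (M1 := A^o) (M2 := A^o)) hmon => c x y.
by rewrite -![c%:A *: _]/(c%:A * _) !mulr_algl hlin.
Qed.

Lemma wspan_sub (P Q : mon n -> Prop) x :
  (forall t, P t -> Q t) -> wspan P x -> wspan Q x.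
Proof. by move=> PQ; apply: (wspan_map (h := id)) => // t /PQ; apply: wspan_gen. Qed.

(** The Bernstein filtration by total degree, with a strict bound. *)
Definition weyl_lt d : A -> Prop := wspan (fun t => (mon_deg t < d)%N).

Lemma weyl_lt_gen d t : (mon_deg t < d)%N -> weyl_lt d (mon_val K t).
Proof. exact: wspan_gen. Qed.

Lemma weyl_lt_mull d d' (x r : A) :
  (forall t, (mon_deg t < d)%N -> weyl_lt d' (x * mon_val K t)) ->
  weyl_lt d r -> weyl_lt d' (x * r).
Proof.
move=> xmon; apply: (wspan_map (h := *%R x)) xmon r => c y z.
by rewrite mulrDr scalerAr.
Qed.

Lemma weyl_lt_D d r i : weyl_lt d r -> weyl_lt d.+1 (weyl_D K i * r).
Proof.
apply: weyl_lt_mull => t t_d; rewrite weyl_DM.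
apply: wspanD; first by apply: weyl_lt_gen; rewrite mon_degM /mon_deg /= mdeg0 mdeg1.
apply: wspanZ.
apply: weyl_lt_gen; apply: leq_ltn_trans (leqW t_d).
by rewrite /mon_deg /= leq_add2r mdegB.
Qed.

Lemma weyl_lt_X d r a : weyl_lt d r -> weyl_lt (mdeg a + d) (mon_val K (a, 0%MM) * r).
Proof.
apply: weyl_lt_mull => t t_d; rewrite mon_valXM; apply: weyl_lt_gen.
by rewrite mon_degM {1}/mon_deg /= mdeg0 addn0 ltn_add2l.
Qed.

(** Induction on the degree of [b], moving one derivation at a time past [t]; each Leibniz
    correction loses degree. *)
Lemma mon_valDM b t :
  weyl_lt (mdeg b + mon_deg t)
    (mon_val K (0%MM, b) * mon_val K t - mon_val K (mon_mul (0%MM, b) t)).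
Proof.
elim: {b}(mdeg b) {-2}b (erefl (mdeg b)) => [|k IH] b deg_b.
  move/eqP: deg_b; rewrite mdeg_eq0 => /eqP ->.
  rewrite mon_val0 mul1r /mon_mul /= !add0m -surjective_pairing subrr.
  exact: kspan0.
have [i b_i] : exists i, b i != 0%N.
  apply/existsP; rewrite -negb_forall; apply: contra_eqN deg_b => /forallP b0.
  by rewrite mdegE big1 // => i _; apply/eqP/b0.
have U_b : (U_(i) <= b)%MM by rewrite lep1mP.
have def_b := submK U_b; set b' := (b - U_(i))%MM in def_b.
have deg_b' : mdeg b' = k.
  by apply: succn_inj; rewrite -deg_b -def_b mdegD mdeg1 addn1.
have -> : mon_val K (0%MM, b) = weyl_D K i * mon_val K (0%MM, b').
  rewrite weyl_DM mnm0E scale0r addr0 /mon_mul /= addm0 addmC def_b //.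
have -> : mon_mul (0%MM, b) t = mon_mul (0%MM, U_(i)%MM) (mon_mul (0%MM, b') t).
  by rewrite mon_mulA /mon_mul /= !add0m [(U_(i) + _)%MM]addmC def_b.
(* The error splits into [d_i] times the inductive error for [b'], and the Leibniz term of [d_i]
   against the product monomial. *)
rewrite -mulrA -[X in X - _](subrK (weyl_D K i * mon_val K (mon_mul (0%MM, b') t))).
rewrite -mulrBr -addrA; apply: wspanD.
  by rewrite deg_b addSn -deg_b'; apply/weyl_lt_D/IH.
rewrite weyl_DM addrAC subrr add0r; apply: wspanZ; apply: weyl_lt_gen.
rewrite deg_b addSn ltnS -deg_b' /mon_deg /= add0m mdegD addnCA leq_add2l leq_add2r.
exact: mdegB.
Qed.

(** Left multiplication by [x^a] is exact on monomials, so only the derivations of [t] have to be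
    moved past [u]. *)
Lemma mon_valM t u : weyl_lt (mon_deg t + mon_deg u)
  (mon_val K t * mon_val K u - mon_val K (mon_mul t u)).
Proof.
case: t => a b; have -> : (a, b) = mon_mul (a, 0%MM) (0%MM, b).
  by rewrite /mon_mul /= addm0 add0m.
rewrite -mon_mulA -!mon_valXM -mulrA -mulrBr mon_degM {1}/mon_deg /= mdeg0 addn0.
rewrite -addnA; apply: weyl_lt_X; rewrite /mon_deg /= mdeg0.
exact: mon_valDM.
Qed.

Lemma weyl_spanM x y :
  wspan xpredT x ->
  wspan xpredT y ->
  wspan xpredT (x * y).
Proof.
move=> span_x span_y; move: x span_x; apply: (wspan_map (h := *%R^~ y)) => [c x z|t _].
  by rewrite mulrDl scalerAl.
move: y span_y; apply: (wspan_map (h := *%R (mon_val K t))) => [c y z|u _].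
  by rewrite mulrDr scalerAr.
rewrite -[_ * _](subrK (mon_val K (mon_mul t u))).
apply: wspanD; last exact: wspan_gen.
by apply: wspan_sub (mon_valM t u).
Qed.

(** The combinations of monomials form a subalgebra containing the [x_i] and [d_i], and the Weyl
    algebra is the smallest such subalgebra. *)
Lemma weyl_span x : wspan xpredT x.
Proof.
pose S : {pred endo K n} := fun f =>
  `[< exists2 y : A, weyl_val y = f & wspan xpredT y >].
have span_mon t : wspan xpredT (mon_val K t).
  exact: wspan_gen.
have : weyl_val x \in S.
  have /asboolP := weyl_valP x; apply.
  - split; first by apply/asboolP; exists 1 => //; rewrite -mon_val0.
    + move=> c _ _ /asboolP[y <- span_y] /asboolP[z <- span_z]; apply/asboolP.
      exists (c *: y + z) => //; apply: wspanD => //.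
      exact: wspanZ.
    + move=> _ _ /asboolP[y <- span_y] /asboolP[z <- span_z]; apply/asboolP.
      by exists (y * z) => //; apply: weyl_spanM.
  - by move=> i; apply/asboolP; exists (weyl_X K i) => //; rewrite -mon_valX.
  - by move=> i; apply/asboolP; exists (weyl_D K i) => //; rewrite -mon_valD.
by case/asboolP => y /val_inj ->.
Qed.

Lemma mon_free (S : seq (mon n)) (c : mon n -> K) :
  [pchar K] =i pred0 -> uniq S -> \sum_(t <- S) c t *: mon_val K t = 0 ->
  {in S, forall t, c t = 0}.
Proof.
move=> charK0 uniqS sum0; have natK k := (pcharf0P _).1 charK0 k.
have subm_self (m : 'X_{1..n}) : (m - m = 0)%MM by apply/mnmP => i; rewrite !mnmE subnn.
suff: forall k t, t \in S -> (mdeg t.2 < k)%N -> c t = 0.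
  by move=> c0 t tS; apply: c0 tS (ltnSn _).
elim=> [|k IH] // [a b] abS /= b_k.
(* The coefficient of [x^a] in the image of [x^b] isolates the term of index [(a, b)]. *)
have := congr1 (fun x => (weyl_app x 'X_[b])@_a) sum0.
rewrite weyl_app0 mcoeff0 weyl_app_sum linear_sum (bigD1_seq _ abS) //=.
rewrite big1_seq ?addr0 => [|[a' b'] /andP[neq_ab ab'S]].
  rewrite weyl_appZ mon_valE mcoeffZ /= mderivmX subm_self mpolyX0 -scalerAr mulr1.
  rewrite mcoeffZ mcoeffX eqxx mulr1 => /eqP; rewrite mulf_eq0 => /orP[/eqP //|].
  (* The other factor is the product of the factorials of the exponents in [b], nonzero in
     characteristic 0. *)
  rewrite natK => /eqP prod0; exfalso; move/eqP: prod0; apply/negP; rewrite -lt0n.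
  by apply: prodn_gt0 => i; rewrite ffactnn fact_gt0.
rewrite weyl_appZ mon_valE mcoeffZ /= mderivmX -scalerAr -mpolyXD mcoeffZ mcoeffX.
(* The other terms vanish: by induction if [b'] has degree below [k]; otherwise [d^b'] kills [x^b]
   unless [b' = b], and then [a'] differs from [a]. *)
case: (ltnP (mdeg b') k) => [b'_k|k_b'].
  by rewrite (IH _ ab'S) ?mul0r.
have [b'_b|] := boolP (b' <= b)%MM; last first.
  rewrite negb_forall => /existsP[i]; rewrite -ltnNge => b_i.
  rewrite (bigD1 i) //= ffact_small // mul0n.
  by rewrite !mul0r mulr0.
have eq_b : b' = b.
  have : mdeg (b - b')%MM = 0%N.
    apply/eqP; rewrite -(eqn_add2r (mdeg b')) -mdegD submK // add0n eqn_leq.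
    by rewrite (leq_trans _ k_b') // -(submK b'_b) mdegD leq_addl.
  by move/eqP; rewrite mdeg_eq0 => /eqP b0; rewrite -[RHS](submK b'_b) b0 add0m.
rewrite eq_b subm_self addm0; case: eqP => [eq_a|_]; last by rewrite !mulr0.
by rewrite eq_a eq_b eqxx in neq_ab.
Qed.

End Weyl.

(** * Coefficients and leading monomials in a free module *)

Section FreeModule.
Local Open Scope ring_scope.
Variables (K : fieldType) (charK0 : [pchar K] =i pred0) (n m : nat).
Variables (E : lmodType (weyl K n)) (e : 'I_m -> E).
Hypothesis e_free : free_generators e.
Local Notation A := (weyl K n).
Implicit Types (f g h : E) (t : mon n) (u v w : emon n m) (x y : A).

Definition emon_val u : E := mon_val K u.1 *: e u.2.

Lemma scalerAlgC x c f : x *: (c%:A *: f) = c%:A *: (x *: f).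
Proof. by rewrite !scalerA mulr_algl mulr_algr. Qed.

Lemma scaler_algA (a b : K) f : a%:A *: (b%:A *: f) = (a * b)%:A *: f.
Proof. by rewrite scalerA mulr_algl [a *: (b *: _)]scalerA. Qed.

Lemma kspan_scale (I : Type) (F : I -> E) (P1 : mon n -> Prop) (P2 : I -> Prop) f x :
  (forall t, P1 t -> kspan F P2 (mon_val K t *: f)) ->
  wspan P1 x -> kspan F P2 (x *: f).
Proof.
move=> Pf; apply: (kspan_map (M1 := A^o) (h := fun y => y *: f)) Pf x => c y z.
by rewrite -[c%:A *: y]/(c%:A * y) scalerDl scalerA.
Qed.

Lemma kspan_mul (I : Type) (F : I -> E) (P1 P2 : I -> Prop) x f :
  (forall i, P1 i -> kspan F P2 (x *: F i)) -> kspan F P1 f -> kspan F P2 (x *: f).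
Proof.
move=> PF; apply: (kspan_map (h := fun f => x *: f)) PF f => c f g.
by rewrite scalerDr scalerAlgC.
Qed.

Lemma kspan_sum (I J : Type) (F : I -> E) (P : I -> Prop) (r : seq J) (B : pred J)
    (H : J -> E) :
  (forall j, B j -> kspan F P (H j)) -> kspan F P (\sum_(j <- r | B j) H j).
Proof.
move=> PH; elim/big_ind: _ => [|f g|]; [exact: kspan0|exact: kspanD|exact: PH].
Qed.

Lemma emon_span f : kspan emon_val xpredT f.
Proof.
have [a [-> _]] := e_free f; apply: kspan_sum => i _.
apply: kspan_scale (weyl_span (a i)) => t _.
exact: (@kspan_gen _ _ _ _ emon_val xpredT (t, i)).
Qed.

(** Summing over any finite superset of the support lets two expansions be compared over a common
    index set. *)
Lemma expansionE f (c : {fsfun emon n m -> K with 0}) (S : {fset emon n m}) :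
  {subset finsupp c <= S} ->
  expansion e f c <-> f = \sum_(u <- S) (c u)%:A *: emon_val u.
Proof.
move=> cS; rewrite /expansion.
have -> : \sum_(u <- finsupp c) (c u *: mon_val K u.1) *: e u.2
    = \sum_(u <- S) (c u)%:A *: emon_val u; last by [].
under [LHS]eq_bigr do rewrite -[_ *: mon_val _ _]mulr_algl -scalerA.
apply: big_fset_incl => [|u _ /fsfun_dflt ->]; last by rewrite !scale0r.
exact/fsubsetP.
Qed.

(** Grouping terms by generator, uniqueness of the coordinates of 0 reduces the claim to
    independence of monomials in the Weyl algebra. *)
Lemma emon_free (S : {fset emon n m}) (c : emon n m -> K) :
  \sum_(u <- S) (c u)%:A *: emon_val u = 0 -> {in S, forall u, c u = 0}.
Proof.
move=> sum0 [t i] tiS.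
pose a := [ffun j : 'I_m => \sum_(u <- S | u.2 == j) c u *: mon_val K u.1].
have a0 : 0 = \sum_(j < m) a j *: e j.
  rewrite -[LHS]sum0 (partition_big (fun u => u.2) xpredT) //=.
  apply: eq_bigr => j _; rewrite ffunE scaler_suml; apply: eq_bigr => u /eqP <-.
  by rewrite /emon_val scalerA mulr_algl.
have z0 : 0 = \sum_(j < m) [ffun _ : 'I_m => 0 : A] j *: e j.
  by rewrite big1 // => j _; rewrite ffunE scale0r.
have [b [_ b_uniq]] := e_free 0.
have := congr1 (fun a : {ffun _} => a i) (etrans (esym (b_uniq _ a0)) (b_uniq _ z0)).
rewrite !ffunE => sum_i.
pose r := [seq u.1 | u <- [seq u <- enum_fset S | u.2 == i]].
have uniq_r : uniq r.
  rewrite map_inj_in_uniq ?filter_uniq ?fset_uniq // => -[t1 i1] [t2 i2].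
  by rewrite !mem_filter /= => /andP[/eqP -> _] /andP[/eqP -> _] ->.
apply: (mon_free (c := fun t => c (t, i)) charK0 uniq_r).
  rewrite -[RHS]sum_i big_map big_filter; apply: eq_bigr => -[t1 i1] /= /eqP ->.
  by [].
by apply/mapP; exists (t, i); rewrite // mem_filter eqxx.
Qed.

Lemma expansion_uniq f (c d : {fsfun emon n m -> K with 0}) :
  expansion e f c -> expansion e f d -> c = d.
Proof.
pose S := (finsupp c `|` finsupp d)%fset.
have cS : {subset finsupp c <= S} by move=> u; rewrite inE => ->.
have dS : {subset finsupp d <= S} by move=> u; rewrite inE orbC => ->.
move=> /(expansionE _ cS) -> /(expansionE _ dS) /eqP; rewrite -subr_eq0 -sumrB.
under eq_bigr do rewrite -scalerBl -scalerBl.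
move=> /eqP /emon_free cd; apply/fsfunP => u.
have [/cd /eqP|uS] := boolP (u \in S); first by rewrite subr_eq0 => /eqP.
rewrite !fsfun_dflt //; first by apply: contra uS => /dS.
by apply: contra uS => /cS.
Qed.

Lemma expansion_exists f : exists c, expansion e f c.
Proof.
elim: (emon_span f) => {f} [|a u f _ _ [c c_f]].
  by exists [fsfun]; rewrite /expansion finsupp0 big_seq_fset0.
pose S := (u |` finsupp c)%fset.
pose d := [fsfun v in S => a *+ (v == u) + c v] : {fsfun emon n m -> K with 0}.
have cS : {subset finsupp c <= S} by move=> v; rewrite !inE orbC => ->.
have dS : {subset finsupp d <= S} by apply/fsubsetP/finsupp_sub.
exists d; apply/(expansionE _ dS); move/(expansionE _ cS): c_f => ->.
have uS : u \in S by rewrite !inE eqxx.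
rewrite [X in _ + X](big_fsetD1 u uS) [RHS](big_fsetD1 u uS) /=.
rewrite addrA -scalerDl -scalerDl; congr (_ *: _ + _).
  by rewrite fsfunE uS eqxx.
rewrite big_seq [RHS]big_seq; apply: eq_bigr => v /fsetD1P[/negPf vu vS].
by rewrite fsfunE vS vu add0r.
Qed.

Lemma coefs_expansion f : expansion e f (coefs e f).
Proof.
rewrite /coefs; case: pselect => [ex|]; first by case: (cid ex).
by case; apply: expansion_exists.
Qed.

Lemma coefsE f (c : {fsfun emon n m -> K with 0}) : expansion e f c -> coefs e f = c.
Proof. exact: expansion_uniq (coefs_expansion f). Qed.

Lemma coefsP a f g u : coefs e (a%:A *: f + g) u = a * coefs e f u + coefs e g u.
Proof.
pose S := (finsupp (coefs e f) `|` finsupp (coefs e g))%fset.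
have fS : {subset finsupp (coefs e f) <= S} by move=> v; rewrite inE => ->.
have gS : {subset finsupp (coefs e g) <= S} by move=> v; rewrite inE orbC => ->.
pose c := [fsfun v in S => a * coefs e f v + coefs e g v]
  : {fsfun emon n m -> K with 0}.
have cS : {subset finsupp c <= S} by apply/fsubsetP/finsupp_sub.
have -> : coefs e (a%:A *: f + g) = c.
  apply/coefsE/(expansionE _ cS).
  have /(expansionE _ fS) {1}-> := coefs_expansion f.
  have /(expansionE _ gS) {1}-> := coefs_expansion g.
  rewrite scaler_sumr -big_split /=; apply: eq_big_seq => v vS.
  by rewrite fsfunE vS scaler_algA -scalerDl -scalerDl.
rewrite fsfunE; case: ifPn => // uS; rewrite !fsfun_dflt ?mulr0 ?addr0 //.
  by apply: contra uS => /gS.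
by apply: contra uS => /fS.
Qed.

Lemma coefs0 u : coefs e 0 u = 0.
Proof.
have := coefsP 1 0 0 u; rewrite scaler0 addr0 mul1r.
by rewrite -{1}[coefs e 0 u]addr0 => /addrI.
Qed.

Lemma coefs_mon u v : coefs e (emon_val u) v = (u == v)%:R.
Proof.
pose c := [fsfun w in [fset u]%fset => 1] : {fsfun emon n m -> K with 0}.
have -> : coefs e (emon_val u) = c.
  apply/coefsE/(@expansionE _ _ [fset u]%fset); first exact/fsubsetP/finsupp_sub.
  by rewrite big_seq_fset1 fsfunE inE eqxx !scale1r.
by rewrite fsfunE inE eq_sym; case: eqP.
Qed.

(** Passes between the two views of a bound on [f]: as a combination of allowed monomials, and as a
    condition on its support. *)
Lemma kspan_coefs (P : emon n m -> Prop) f :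
  kspan emon_val P f <-> (forall u, coefs e f u != 0 -> P u).
Proof.
split=> [|Pf].
  elim=> [|a u g Pu _ IH] v; first by rewrite coefs0 eqxx.
  rewrite coefsP coefs_mon; have [<- //|_] := eqVneq u v.
  by rewrite mulr0 add0r; apply: IH.
have /(@expansionE _ _ (finsupp (coefs e f)) (fun _ => id)) -> := coefs_expansion f.
rewrite big_seq; apply: kspan_sum => u; rewrite mem_finsupp => /Pf Pu.
exact/kspanZ/kspan_gen.
Qed.

(** By antisymmetry at most one monomial passes the filter in [LM], so taking the head of the list
    involves no choice. *)
Lemma LMP f u : LM e f = Some u <->
  coefs e f u != 0 /\ (forall v, coefs e f v != 0 -> emon_le v u).
Proof.
have memS v : (v \in finsupp (coefs e f)) = (coefs e f v != 0) by rewrite mem_finsupp.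
have memLM v : v \in [seq u <- finsupp (coefs e f) |
      all (fun v => (v == u) || emon_lt v u) (finsupp (coefs e f))] <->
    coefs e f v != 0 /\ (forall w, coefs e f w != 0 -> emon_le w v).
  rewrite mem_filter memS; split=> [/andP[/allP le_v v0]|[v0 le_v]].
    by split=> // w; rewrite -memS => /le_v.
  by rewrite v0 andbT; apply/allP => w; rewrite memS => /le_v.
rewrite /LM -memLM; split.
  by case: [seq _ <- _ | _] => //= v s [->]; rewrite mem_head.
move=> u_s; case: [seq _ <- _ | _] memLM u_s => //= v s memLM /memLM[u0 le_u].
have /memLM[v0 le_v] := mem_head v s; congr Some.
by apply/emon_key_inj/le_anti; rewrite -!emon_leE le_u ?le_v.
Qed.

Lemma LM_exists f : f <> 0 -> exists u, LM e f = Some u.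
Proof.
move=> f0; have [u u_f] : exists u, coefs e f u != 0.
  apply: contrapT => no_u; apply: f0.
  rewrite [LHS]coefs_expansion big_seq big1 // => u; rewrite mem_finsupp => u_f.
  by case: no_u; exists u.
suff: exists u, coefs e f u != 0 /\ forall v, v \in finsupp (coefs e f) -> emon_le v u.
  case=> w [w0 w_max]; exists w; apply/LMP; split=> // v.
  by rewrite -mem_finsupp; apply: w_max.
have {u u_f} : exists2 u, u \in enum_fset (finsupp (coefs e f)) & true.
  by exists u; rewrite // mem_finsupp.
(* Generalized to arbitrary nonempty lists, so that the maximum is found by induction on the
   list. *)
suff: forall r : seq (emon n m), (exists2 u, u \in r & true) ->
    exists u, u \in r /\ forall v, v \in r -> emon_le v u.
  by move=> max_r /max_r[w [w_r w_max]]; exists w; rewrite -mem_finsupp.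
elim=> [|u r IH] [w w_r _]; first by rewrite in_nil in w_r.
case: r => [|u' r] in IH w_r *.
  by exists u; rewrite mem_head; split=> // v; rewrite inE => /eqP ->; apply: emon_lexx.
have [|v [v_r v_max]] := IH; first by exists u'; rewrite // mem_head.
have [uv|vu] := orP (emon_le_total u v).
  by exists v; rewrite inE v_r orbT; split=> // x; rewrite inE => /predU1P[->|/v_max].
exists u; rewrite mem_head; split=> // x; rewrite inE => /predU1P[->|/v_max xv].
  exact: emon_lexx.
exact: emon_le_trans vu.
Qed.

Definition below u : E -> Prop := kspan emon_val (fun v => emon_lt v u).

(** Here [c] may be 0, unlike for [LC] of a nonzero element, so that scaling needs no side
    condition. *)
Definition lead (c : K) u f : Prop := below u (f - c%:A *: emon_val u).

Lemma coefs_lead c u f : lead c u f -> coefs e f u = c.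
Proof.
move=> /kspan_coefs lead_f; rewrite -[f](subrK (c%:A *: emon_val u)) addrC coefsP.
rewrite coefs_mon eqxx mulr1; apply/eqP; rewrite -subr_eq0 addrAC subrr add0r.
by apply: contraT => /lead_f; rewrite emon_ltxx.
Qed.

Lemma lead_below c u w f : lead c u f -> emon_lt u w -> below w f.
Proof.
move=> lead_f u_w; rewrite -[f](subrK (c%:A *: emon_val u)).
apply: kspanD; last exact/kspanZ/kspan_gen.
by apply: kspan_sub lead_f => v /emon_lt_trans; apply.
Qed.

Lemma LM_lead c u f : c != 0 -> lead c u f -> LM e f = Some u.
Proof.
move=> c0 lead_f; apply/LMP; rewrite (coefs_lead lead_f); split=> // v v_f.
rewrite /emon_le; have [//|/= vu] := eqVneq v u.
move/kspan_coefs: lead_f; apply; rewrite addrC -scaleNr -scaleNr coefsP.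
by rewrite coefs_mon [u == v]eq_sym (negPf vu) mulr0 add0r.
Qed.

Lemma LC_lead f u : LM e f = Some u -> LC e f != 0 /\ lead (LC e f) u f.
Proof.
rewrite /LC => LMf; rewrite LMf; move/LMP: LMf => [u0 u_max]; split=> //.
apply/kspan_coefs => v; rewrite addrC -scaleNr -scaleNr coefsP coefs_mon.
have [<-|uv] := eqVneq u v; first by rewrite mulr1 addNr eqxx.
by rewrite mulr0 add0r => /u_max /predU1P[vu|//]; rewrite vu eqxx in uv.
Qed.

Lemma LM_below f u w : LM e f = Some u -> below w f -> emon_lt u w.
Proof. by move=> /LMP[u0 _] /kspan_coefs; apply. Qed.

Lemma leadZ a c u f : lead c u f -> lead (a * c) u (a%:A *: f).
Proof.
by move=> /(kspanZ a); rewrite scalerBr scalerA mulr_algl [a *: (c *: _)]scalerA.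
Qed.

Lemma leadB c u f g : lead c u f -> lead c u g -> below u (f - g).
Proof. by move=> lead_f /(kspanB lead_f); rewrite opprB addrA subrK. Qed.

(** The error has smaller degree, and the order compares degrees first. *)
Lemma mon_mul_below t u :
  below (emon_mul t u) (mon_val K t *: emon_val u - emon_val (emon_mul t u)).
Proof.
rewrite /emon_val scalerA -scalerBl.
apply: kspan_scale (mon_valM K t u.1) => t' t'_deg.
apply: (@kspan_gen _ _ _ _ emon_val _ (t', u.2)); apply: emon_lt_deg.
by rewrite mon_degM.
Qed.

Lemma below_mul t u f : below u f -> below (emon_mul t u) (mon_val K t *: f).
Proof.
apply: kspan_mul => v v_u; rewrite -[_ *: _](subrK (emon_val (emon_mul t v))).
apply: kspanD; last by apply: kspan_gen; rewrite emon_lt_mul2l.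
apply: kspan_sub (mon_mul_below t v) => w /emon_lt_trans; apply.
by rewrite emon_lt_mul2l.
Qed.

Lemma lead_mul t c u f : lead c u f -> lead c (emon_mul t u) (mon_val K t *: f).
Proof.
move=> /(below_mul t); rewrite scalerBr scalerAlgC => lead_f.
have := kspanD lead_f (kspanZ c (mon_mul_below t u)).
by rewrite scalerBr addrA subrK.
Qed.

End FreeModule.

(** * Divisibility and least common multiples of monomials *)

Section DivisionOrder.
Variables (n m : nat).
Implicit Types (t : mon n) (u v w : emon n m).

Lemma mon_quoK t1 t2 : mon_dvd t1 t2 -> mon_mul (mon_quo t2 t1) t1 = t2.
Proof. by case: t2 => a b /andP[d1 d2]; rewrite /mon_mul /= !submK. Qed.

Lemma emon_quoK u v : emon_dvd u v -> emon_mul (mon_quo v.1 u.1) u = v.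
Proof.
by case: v => t i /andP[/eqP u2 /mon_quoK quoK]; rewrite /emon_mul quoK u2.
Qed.

Lemma emon_dvd_mul t u : emon_dvd u (emon_mul t u).
Proof. by rewrite /emon_dvd eqxx /= /mon_dvd !lem_addl. Qed.

Lemma emon_mulI u : injective (fun t => emon_mul t u).
Proof.
move=> [a b] [c d] eq_u; congr pair.
  exact: addIm (congr1 (fun w => w.1.1) eq_u).
exact: addIm (congr1 (fun w => w.1.2) eq_u).
Qed.

(** A common multiple forces [u] and [v] onto the same generator, so their lcm is not the value
    [None] standing for 0. *)
Lemma emon_lcm_dvd u v w : emon_dvd u w -> emon_dvd v w ->
  exists L, [/\ emon_lcm u v = Some L, emon_dvd u L, emon_dvd v L & emon_dvd L w].
Proof.
case: u v w => [[a1 b1] i] [[a2 b2] j] [[a b] k].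
move=> /andP[/= /eqP -> /andP[/= /mnm_lepP a1a /mnm_lepP b1b]].
move=> /andP[/= /eqP -> /andP[/= /mnm_lepP a2a /mnm_lepP b2b]].
rewrite /emon_lcm eqxx; eexists; split; first by [].
- by rewrite /emon_dvd /mon_dvd /= eqxx !mlcmE !lem_addr.
- by rewrite /emon_dvd /mon_dvd /= eqxx
    [mlcm a1 _]mlcmC [mlcm b1 _]mlcmC !mlcmE !lem_addr.
rewrite /emon_dvd /mon_dvd /= eqxx /=.
by apply/andP; split; apply/mnm_lepP => x; rewrite !mnmE geq_max ?a1a ?b1b ?a2a ?b2b.
Qed.

End DivisionOrder.

(** * Buchberger's criterion *)

Section Buchberger.
Local Open Scope ring_scope.
Variables (K : fieldType) (charK0 : [pchar K] =i pred0) (n m : nat).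
Variables (E : lmodType (weyl K n)) (e : 'I_m -> E).
Hypothesis e_free : free_generators e.
Variables (s : nat) (G : 'I_s -> E) (l : 'I_s -> emon n m).
Hypothesis LM_G : forall i, LM e (G i) = Some (l i).
Implicit Types (f g h : E) (t : mon n) (u v w : emon n m) (i j : 'I_s).

Let LC_neq0 i : LC e (G i) != 0.
Proof. by have [] := LC_lead charK0 e_free (LM_G i). Qed.

Definition mon_gen (p : mon n * 'I_s) : E := mon_val K p.1 *: G p.2.
Definition lead_gen (p : mon n * 'I_s) : emon n m := emon_mul p.1 (l p.2).

Lemma lead_mon_gen p : lead e (LC e (G p.2)) (lead_gen p) (mon_gen p).
Proof. by apply: lead_mul; have [] := LC_lead charK0 e_free (LM_G p.2). Qed.

(** Stronger than [below]: every product in the combination is below [w], so no cancellation of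
    larger leading monomials is involved. *)
Definition gen_below w : E -> Prop := kspan mon_gen (fun p => emon_lt (lead_gen p) w).
Definition gen_upto w : E -> Prop := kspan mon_gen (fun p => emon_le (lead_gen p) w).

Lemma gen_below_below w f : gen_below w f -> below e w f.
Proof.
by apply: (kspan_map (h := id)) => // p /(lead_below (lead_mon_gen p)).
Qed.

Lemma gen_below_scale w i d r : (d + mon_deg (l i).1 <= mon_deg w.1)%N ->
  weyl_lt d r -> gen_below w (r *: G i).
Proof.
move=> d_w; apply: kspan_scale => t t_d.
apply: (@kspan_gen _ _ _ _ mon_gen _ (t, i)); apply: emon_lt_deg.
by rewrite mon_degM; apply: leq_trans d_w; rewrite ltn_add2r.
Qed.

Lemma gen_below_mon t p :
  gen_below (emon_mul t (lead_gen p))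
    (mon_val K t *: mon_gen p - mon_gen (mon_mul t p.1, p.2)).
Proof.
rewrite /mon_gen scalerA -scalerBl; apply: gen_below_scale (mon_valM K t p.1).
by rewrite !mon_degM addnA.
Qed.

Lemma gen_below_mul t w f :
  gen_below w f -> gen_below (emon_mul t w) (mon_val K t *: f).
Proof.
apply: kspan_mul => p p_w; rewrite -[_ *: _](subrK (mon_gen (mon_mul t p.1, p.2))).
apply: kspanD.
  apply: kspan_sub (gen_below_mon t p) => q /emon_lt_trans; apply.
  by rewrite emon_lt_mul2l.
by apply: kspan_gen; rewrite /lead_gen /= -emon_mulA emon_lt_mul2l.
Qed.

(** A reduction to 0 writes [f] as the sum of the subtracted multiples. Each leads with a monomial
    present in the current remainder, and remainders stay below [w]. *)
Lemma reduces_gen_below w f : below e w f -> reduces e G f 0 -> gen_below w f.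
Proof.
(* The end point 0 becomes a variable [z], as induction on the reduction sequence requires. *)
move=> f_w red; suff: forall z, reduces e G f z -> z = 0 -> gen_below w f.
  by move=> red0; apply: red0 red _.
move=> z {}red; elim: red f_w => {f z}
  [f|f g h [i [_ [v [u [LMv u_f v_u g_f]]]]] _ IH] f_w.
  by move=> ->; apply: kspan0.
move=> h0; move: LMv; rewrite LM_G => -[lv]; rewrite -{v}lv in v_u g_f.
have u_w : emon_lt u w.
  by move: u_f; rewrite mem_finsupp;
    apply: (kspan_coefs charK0 e_free _ _).1 f_w u.
pose p := (mon_quo u.1 (l i).1, i).
have term_p : term_quo (coefs e f u) u (LC e (G i)) (l i) *: G i
    = (coefs e f u / LC e (G i))%:A *: mon_gen p.
  by rewrite /mon_gen /term_quo scalerA mulr_algl.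
have p_u : lead_gen p = u by apply: emon_quoK.
rewrite -[f](subrK (term_quo (coefs e f u) u (LC e (G i)) (l i) *: G i)) -g_f term_p.
apply: kspanD; last by apply/kspanZ/kspan_gen; rewrite p_u.
apply: IH (h0); rewrite g_f term_p; apply: kspanB => //; apply: kspanZ.
by apply: lead_below (lead_mon_gen p) _; rewrite p_u.
Qed.

Lemma gen_neq0 i : G i <> 0.
Proof.
by move=> Gi0; have /LMP[] := LM_G i; rewrite Gi0 coefs0 // eqxx.
Qed.

Lemma submod_genB f g x : submod_gen G f -> submod_gen G g -> submod_gen G (f - x *: g).
Proof.
move=> [a ->] [b ->]; exists (fun i => a i - x * b i).
rewrite scaler_sumr -sumrB; apply: eq_bigr => i _.
by rewrite scalerBl scalerA.
Qed.

Lemma submod_gen_mem i : submod_gen G (G i).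
Proof.
exists (fun j => (j == i)%:R); rewrite (bigD1 i) //= eqxx scale1r.
by rewrite big1 ?addr0 // => j /negPf ->; rewrite scale0r.
Qed.

Lemma submod_gen0 : submod_gen G 0.
Proof. by exists (fun=> 0); rewrite big1 // => i _; rewrite scale0r. Qed.

Lemma submod_gen_Spoly i j : submod_gen G (Spoly e (G i) (G j)).
Proof.
rewrite /Spoly !LM_G; case: emon_lcm => [L|]; last exact: submod_gen0.
apply: submod_genB (submod_gen_mem j).
have := submod_genB (- term_quo 1 L (LC e (G i)) (l i)) submod_gen0 (submod_gen_mem i).
by rewrite scaleNr opprK add0r.
Qed.

Section SpolyReduces.
Hypothesis Spoly_red : forall i j, i != j -> reduces e G (Spoly e (G i) (G j)) 0.

(* With [w = tau L], [L] the lcm of the two leading monomials, the difference is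
   [tau] times the S-polynomial, up to terms of lower degree. *)
Lemma gen_below_diff p q w : lead_gen p = w -> lead_gen q = w ->
  gen_below w ((LC e (G p.2))^-1%:A *: mon_gen p - (LC e (G q.2))^-1%:A *: mon_gen q).
Proof.
case: p q => [t i] [t' j] /= p_w q_w.
have [eq_ij|neq_ij] := eqVneq i j.
  rewrite -{}eq_ij in q_w *.
  have -> : t = t' by apply: (@emon_mulI _ _ (l i)); rewrite [LHS]p_w.
  by rewrite subrr; apply: kspan0.
have li_w : emon_dvd (l i) w by rewrite -p_w emon_dvd_mul.
have lj_w : emon_dvd (l j) w by rewrite -q_w emon_dvd_mul.
have [L [lcm_L li_L lj_L L_w]] := emon_lcm_dvd li_w lj_w.
pose tau := mon_quo w.1 L.1.
pose pi := (mon_quo L.1 (l i).1, i); pose pj := (mon_quo L.1 (l j).1, j).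
have pi_L : lead_gen pi = L by apply: emon_quoK.
have pj_L : lead_gen pj = L by apply: emon_quoK.
have tau_L : emon_mul tau L = w by apply: emon_quoK.
have def_t : t = mon_mul tau pi.1.
  apply: (@emon_mulI _ _ (l i)); rewrite -[LHS]/(lead_gen (t, i)).
  by rewrite p_w -emon_mulA -tau_L -{1}pi_L.
have def_t' : t' = mon_mul tau pj.1.
  apply: (@emon_mulI _ _ (l j)); rewrite -[LHS]/(lead_gen (t', j)).
  by rewrite q_w -emon_mulA -tau_L -{1}pj_L.
have SE : Spoly e (G i) (G j) =
    (LC e (G i))^-1%:A *: mon_gen pi - (LC e (G j))^-1%:A *: mon_gen pj.
  by rewrite /Spoly !LM_G lcm_L /term_quo /mon_gen !mul1r !scalerA !mulr_algl.
(* Both products are normalized to leading coefficient 1 at [L], so their leading terms cancel. *)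
have S_L : below e L (Spoly e (G i) (G j)).
  have lead1 p : lead_gen p = L -> lead e 1 L ((LC e (G p.2))^-1%:A *: mon_gen p).
    by move=> <-; rewrite -(mulVf (LC_neq0 p.2)); apply/leadZ/lead_mon_gen.
  by rewrite SE; apply: leadB (lead1 pi pi_L) (lead1 pj pj_L).
have := gen_below_mul tau (reduces_gen_below S_L (Spoly_red neq_ij)).
rewrite SE tau_L scalerBr !scalerAlgC => S_w.
(* [tau] times a product is again a product only up to terms below [w]; these two facts supply the
   corrections. *)
have pi_w := kspanZ (LC e (G i))^-1 (gen_below_mon tau pi).
have pj_w := kspanZ (LC e (G j))^-1 (gen_below_mon tau pj).
rewrite pi_L tau_L /= -def_t in pi_w; rewrite pj_L tau_L /= -def_t' in pj_w.
have := kspanD (kspanB S_w pi_w) pj_w; rewrite !scalerBr opprB.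
by rewrite [X in X + _]addrC [X in X + _]addrA subrK addrA subrK.
Qed.

(** All products leading with [w] are merged into a single one, at the cost of terms below [w]. *)
Lemma gen_upto_top w f : gen_upto w f -> gen_below w f \/
  exists c p, [/\ c != 0, lead_gen p = w & gen_below w (f - c%:A *: mon_gen p)].
Proof.
elim=> [|c p g p_w _ IH]; first by left; apply: kspan0.
have [p_lt_w|p_nlt_w] := boolP (emon_lt (lead_gen p) w).
  case: IH => [g_w|[d [q [d0 q_w g_w]]]]; first by left; apply: kspan_add.
  by right; exists d, q; split; rewrite // -addrA; apply: kspan_add.
have {p_w p_nlt_w} p_w : lead_gen p = w by case/predU1P: p_w p_nlt_w => [->|->].
case: IH => [g_w|[d [q [d0 q_w g_w]]]].
  have [->|c0] := eqVneq c 0; first by left; rewrite !scale0r add0r.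
  by right; exists c, p; split; rewrite // addrC addKr.
(* Chosen so that [b] times the product of [q] has the same leading coefficient as [c] times the
   product of [p]. *)
pose b := c * LC e (G p.2) / LC e (G q.2).
have pq_w : gen_below w (c%:A *: mon_gen p - b%:A *: mon_gen q).
  have := kspanZ (c * LC e (G p.2)) (gen_below_diff p_w q_w).
  by rewrite scalerBr !scaler_algA mulfK.
have sum_w : gen_below w (c%:A *: mon_gen p + g - (b + d)%:A *: mon_gen q).
  by rewrite [(b + d)%:A]scalerDl scalerDl opprD addrACA; apply: kspanD.
have [bd0|bd0] := eqVneq (b + d) 0; last by right; exists (b + d), q.
by left; move: sum_w; rewrite bd0 !scale0r subr0.
Qed.

(** Takes the greatest leading monomial among finitely many products. Keeping [P p] is what makes
    the new bound strictly smaller than [w] when [P] says so. *)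
Lemma gen_bound (P : mon n * 'I_s -> Prop) f : kspan mon_gen P f ->
  f = 0 \/ exists2 p, P p & gen_upto (lead_gen p) f.
Proof.
elim=> [|c p g Pp _ IH]; first by left.
have gen_p : gen_upto (lead_gen p) (c%:A *: mon_gen p).
  by apply/kspanZ/kspan_gen/emon_lexx.
right; case: IH => [->|[q Pq g_q]]; first by exists p; rewrite // addr0.
have [pq|qp] := orP (emon_le_total (lead_gen p) (lead_gen q)).
  exists q => //; apply: kspanD => //.
  by apply: kspan_sub gen_p => r r_p; apply: emon_le_trans pq.
exists p => //; apply: kspanD => //.
by apply: kspan_sub g_q => r r_q; apply: emon_le_trans qp.
Qed.

Lemma gen_upto_LM w f : gen_upto w f -> f <> 0 ->
  exists i u, LM e f = Some u /\ emon_dvd (l i) u.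
Proof.
elim/(well_founded_induction (@emon_lt_wf n m)): w f => w IH f f_w f0.
(* With no product left at [w], a smaller bound allows induction; otherwise the surviving product
   makes [w] the leading monomial of [f]. *)
case: (gen_upto_top f_w) => [/gen_bound[//|[p p_w f_p]]|[c [p [c0 p_w f_cp]]]].
  exact: IH p_w f f_p f0.
exists p.2, w; split; last by rewrite -p_w emon_dvd_mul.
apply: (LM_lead charK0 e_free (mulf_neq0 c0 (LC_neq0 p.2))).
have lead_p := leadZ c (lead_mon_gen p); rewrite p_w in lead_p.
have := kspanD (gen_below_below f_cp) lead_p.
by rewrite addrA subrK.
Qed.

Lemma Spoly_groebner : groebner_basis e (submod_gen G) G.
Proof.
split=> [i|f [a f_a] f0].
  by split; [apply: submod_gen_mem|apply: gen_neq0].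
have : kspan mon_gen xpredT f.
  rewrite f_a; apply: kspan_sum => i _; apply: kspan_scale (weyl_span (a i)) => t _.
  exact: (@kspan_gen _ _ _ _ mon_gen xpredT (t, i)).
case/gen_bound => [//|[p _ /gen_upto_LM /(_ f0)[i [u [LMf i_u]]]]].
by exists i, (l i), u; rewrite LM_G.
Qed.

End SpolyReduces.

(** Division algorithm: reducing the leading monomial stays in the submodule and strictly lowers the
    leading monomial, so it ends at 0 by well-foundedness. *)
Lemma groebner_reduces f :
  groebner_basis e (submod_gen G) G -> submod_gen G f -> reduces e G f 0.
Proof.
move=> [_ gb] Nf; have [->|] := pselect (f = 0); first exact: rt1n_refl.
move=> f0; have [u LMf] := LM_exists e_free f0.
elim/(well_founded_induction (@emon_lt_wf n m)): u f LMf Nf f0 => u IH f LMf Nf f0.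
have [i [v [u' [LMi]]]] := gb f Nf f0.
rewrite LMf => -[<-]; move: LMi; rewrite LM_G => -[<-] i_u.
pose p := (mon_quo u.1 (l i).1, i).
have p_u : lead_gen p = u by apply: emon_quoK.
have u_f : coefs e f u != 0 by have /LMP[] := LMf.
have [_ lead_f] := LC_lead charK0 e_free LMf.
have LCf : LC e f = coefs e f u by rewrite /LC LMf.
pose h := f - term_quo (coefs e f u) u (LC e (G i)) (l i) *: G i.
have h_u : below e u h.
  (* The subtracted multiple has the same leading term as [f], after dividing by and multiplying
     back [LC e (G i)]. *)
  apply: leadB lead_f _.
  have := leadZ (coefs e f u / LC e (G i)) (lead_mon_gen p).
  by rewrite p_u divfK ?LC_neq0 // LCf /mon_gen /term_quo scalerA mulr_algl.
have Nh : submod_gen G h by apply: submod_genB => //; apply: submod_gen_mem.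
have f_h : reduces1 e (G i) f h.
  split; first exact: gen_neq0.
  by exists (l i), u; split; rewrite ?mem_finsupp.
apply: (rt1n_trans _ _ _ h); first by exists i.
have [->|h0] := pselect (h = 0); first exact: rt1n_refl.
have [w LMh] := LM_exists e_free h0.
by apply: (IH w) => //; apply: LM_below LMh h_u.
Qed.

End Buchberger.

Theorem theorem6 (K : fieldType) (charK0 : [pchar K]%R =i pred0)
    (n : nat) (n_gt0 : 0 < n)
    (E : lmodType (weyl K n)) (m : nat) (e : 'I_m -> E)
    (e_free : free_generators e)
    (s : nat) (G : 'I_s -> E) (G_neq0 : forall i : 'I_s, G i <> 0%R) :
  groebner_basis e (submod_gen G) G <->
  (forall i j : 'I_s, i != j -> reduces e G (Spoly e (G i) (G j)) 0%R).
Proof.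
have [l LM_G] := choice (fun i => LM_exists e_free (G_neq0 i)).
split=> [gb i j _|]; last exact: Spoly_groebner LM_G.
exact: (groebner_reduces charK0 e_free LM_G gb) (submod_gen_Spoly LM_G i j).
Qed.
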